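(* Let $\ell\ge1$. Define polynomials $g_{\ell,n}^m(q,x)$ for integers $n\ge m\ge0$ by $g_{\ell,n}^n(q,x)=g_{\ell,n}(q,x)$ and $$g_{\ell,n}^m(q,x)=g_{\ell,n}^{m+1}(q,x)-x\,q^{\ell(n-m-1)}g_{\ell,n-1}^m(q,x)\qquad(0\le m\le n-1).$$ Then for all $n\ge m\ge0$, $$g_{\ell,n}^m(q,x)=\sum_{k=0}^{n-m}(-x)^k{n-m\brack k}_{q^\ell}q^{\ell\binom{k}{2}}g_{\ell,n-k}(q,x),$$ and $$g_{\ell,n}^m(q,x)=\sum_{\sigma\in G_{\ell,n}^m}q^{\mathrm{fmaf}\,\sigma}x^{\mathrm{fix}\,\sigma}.$$
   Context: Let $\ell,n\ge 1$, $\zeta=e^{2\pi i/\ell}$, $C_\ell=\{1,\zeta,\dots,\zeta^{\ell-1}\}$, $\Sigma_{\ell,n}=\{\zeta^jk:0\le j\le\ell-1,\ 1\le k\le n\}$. $G_{\ell,n}$ is the set of permutations $\sigma$ of $\Sigma_{\ell,n}$ with $\sigma(\zeta^jk)=\zeta^j\sigma(k)$, written as the word $x_1\cdots x_n$ with $x_i=\sigma(i)$ ($G_{\ell,0}$ consists of the empty permutation). For $x=\zeta^jk$ write $\varepsilon_x=\zeta^j$, $|x|=k$. Order $C_\ell$ by $1>\zeta>\cdots>\zeta^{\ell-1}$ and $\Sigma_{\ell,n}$ by: $x<y$ iff $\varepsilon_x<\varepsilon_y$, or $\varepsilon_x=\varepsilon_y$ and $|x|<|y|$ ($i\in[n]$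 identified with $\zeta^0i$). For a word $w_1\cdots w_m$, $\mathrm{maj}\,w=\sum_{i=1}^{m-1}i\,\chi(w_i>w_{i+1})$. For $\sigma\in G_{\ell,n}$: $\mathrm{FIX}(\sigma)=\{i:x_i=i\}$, $\mathrm{fix}\,\sigma=|\mathrm{FIX}(\sigma)|$; $\mathrm{col}\,\sigma=\sum_i j_i$ where $x_i=\zeta^{j_i}|x_i|$, $0\le j_i<\ell$. $\mathrm{Der}(\sigma)$: delete fixed points to get $y_1\cdots y_m$, then $\mathrm{Der}(\sigma)=z_1\cdots z_m$, $z_i=\varepsilon_{y_i}\mathrm{rank}(|y_i|)$ with rank the increasing bijection $\{|y_1|,\dots,|y_m|\}\to[m]$. If $\mathrm{FIX}(\sigma)=\{i_1<\dots<i_k\}$, $\mathrm{maf}\,\sigma=\mathrm{maj}\,\mathrm{Der}(\sigma)+\sum_{j=1}^k(i_j-j)$, and $\mathrm{fmaf}\,\sigma=\ell\,\mathrm{maf}\,\sigma+\mathrm{col}\,\sigma$. $G_{\ell,n}^m=\{\sigma\in G_{\ell,n}:\sigma(i)\ne i\text{ for all }i\le n-m\}$. $[n]_q=1+q+\dots+q^{n-1}$; $(a;q)_n=\prod_{k=0}^{n-1}(1-aq^k)$; ${n\brack m}_q=\frac{(q;q)_n}{(q;q)_m(q;q)_{n-m}}$. For $n\ge0$, $$g_{\ell,n}(q,x)=[\ell]_q[2\ell]_q\cdots[n\ell]_q\sum_{k=0}^n\frac{(x-1)(x-q^\ell)\cdots(x-q^{\ell(k-1)})}{[\ell]_q[2\ell]_q\cdots[k\ell]_q}.$$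 *)

(* Defs.v *)
From HB Require Import structures.
From mathcomp Require Import all_boot all_order all_algebra all_fingroup fraction.
Set Implicit Arguments. Unset Strict Implicit. Unset Printing Implicit Defensive.
Import Order.TTheory GRing.Theory Num.Theory.
Local Open Scope ring_scope.

Definition K : fieldType := {fraction {poly int}}.
Definition qq : K := FracField.tofrac ('X : {poly int}).

Definition qint (n : nat) : K := \sum_(i < n) qq ^+ i.

Definition qfactl (l n : nat) : K := \prod_(1 <= j < n.+1) qint (j * l).

Definition qpoch (a Q : K) (n : nat) : K := \prod_(k < n) (1 - a * Q ^+ k).

Definition qbin (Q : K) (n m : nat) : K :=
  qpoch Q Q n / (qpoch Q Q m * qpoch Q Q (n - m)).

Definition gln (l n : nat) : {poly K} :=
  (qfactl l n)%:P *
  \sum_(k < n.+1)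
     (\prod_(i < k) ('X - (qq ^+ (l * i))%:P)) * ((qfactl l k)^-1)%:P.

(* sigma in G_{l,n} is encoded by (pi, c): sigma(i) = zeta^(c i) * pi(i),
   with positions/values 'I_n standing for 1..n. *)
Definition colperm (l n : nat) : finType :=
  ({perm 'I_n} * {ffun 'I_n -> 'I_l})%type.

(* a letter zeta^j k is encoded as the pair (j, k) *)
Definition letter := (nat * nat)%type.

(* x < y iff eps_x < eps_y (i.e. larger color exponent, since
   1 > zeta > ... > zeta^(l-1)), or same color and |x| < |y| *)
Definition letter_lt (x y : letter) : bool :=
  (y.1 < x.1)%N || ((x.1 == y.1) && (x.2 < y.2)%N).

Definition maj (w : seq letter) : nat :=
  (\sum_(0 <= i < (size w).-1)
      i.+1 * letter_lt (nth (0%N, 0%N) w i.+1) (nth (0%N, 0%N) w i))%N.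

Section ColPerm.
Variables (l n : nat).
Implicit Types (s : colperm l n).

Definition cword s : seq letter :=
  [seq (nat_of_ord (s.2 i), (s.1 i).+1) | i <- enum 'I_n].

Definition isfix s (i : 'I_n) : bool := (s.1 i == i) && (nat_of_ord (s.2 i) == 0%N).

Definition FIXs s : seq nat := [seq (nat_of_ord i).+1 | i <- enum 'I_n & isfix s i].

Definition fixn s : nat := size (FIXs s).

Definition col s : nat := (\sum_(i < n) s.2 i)%N.

Definition Der s : seq letter :=
  let y := [seq (nat_of_ord (s.2 i), (s.1 i).+1) | i <- enum 'I_n & ~~ isfix s i] in
  let absy := [seq a.2 | a <- y] in
  [seq (a.1, (count (fun b => b < a.2)%N absy).+1) | a <- y].

Definition maf s : nat :=
  (maj (Der s) + \sum_(j < size (FIXs s)) (nth 0%N (FIXs s) j - j.+1))%N.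

Definition fmaf s : nat := (l * maf s + col s)%N.

Definition inGm (m : nat) s : bool :=
  [forall i : 'I_n, (i < n - m)%N ==> ~~ isfix s i].

End ColPerm.

(* Main.v *)
(** Write [Q] for q^l and let d_n be the sum of q^fmaf over the fixed-point-free
elements of G_{l,n}. Removing the first fixed point, when it sits at n-m, lowers
maf by n-m-1; this is exactly the recurrence defining g^m_n, and the explicit
formula satisfies the same recurrence by the q-Pascal rule. It remains to treat
m = n. Inserting fixed points one by one gives the sum over G_{l,n} as
P_n = \sum_k x^k [n choose k]_Q d_{n-k}, which like g_{l,n} satisfies
P_n(Qx) - P_n(x) = (Q^n - 1) x P_{n-1}(x); such a family is determined by its
values at x = 1. There g_{l,n}(1) = [l][2l]...[nl], the generating function of
l maj + col (MacMahon). The matching value of P_n is Wachs's theorem: the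
descents of a word are unchanged when every fixed point is replaced by a symbol
lying below the excedances of color 0 and above all other letters, so words with
a prescribed Der are the shuffles of Der with k copies of that symbol, and these
have maj generating function Q^{maj Der} [n choose k]_Q (Garsia and Gessel). *)
Require Import Defs.
From HB Require Import structures.
From mathcomp Require Import all_boot all_order all_algebra all_fingroup fraction.
From mathcomp Require Import zify ring.
Set Implicit Arguments. Unset Strict Implicit. Unset Printing Implicit Defensive.
Import Order.TTheory GRing.Theory Num.Theory.
Local Open Scope ring_scope.

(** * Gaussian binomials and shuffles *)

Fixpoint gauss (R : comNzRingType) (Q : R) (n k : nat) : R :=
  match n, k with
  | _, 0 => 1
  | 0, _.+1 => 0
  | n'.+1, k'.+1 => gauss Q n' k' + Q ^+ k * gauss Q n' k
  end.

Section Gauss.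
Variables (R : comNzRingType) (Q : R).

Lemma gauss0 n : gauss Q n 0 = 1. Proof. by case: n. Qed.

Lemma gaussS n k :
  gauss Q n.+1 k.+1 = gauss Q n k + Q ^+ k.+1 * gauss Q n k.+1.
Proof. by []. Qed.

Lemma gauss_small n k : (n < k)%N -> gauss Q n k = 0.
Proof.
elim: n k => [|n IHn] [|k] //= nk; rewrite !IHn ?mulr0 ?addr0 //; exact: ltnW.
Qed.

Lemma gaussnn n : gauss Q n n = 1.
Proof. by elim: n => //= n ->; rewrite gauss_small // mulr0 addr0. Qed.

(** The ratios of neighbouring Gaussian binomials, cleared of denominators so that [Q] may be
    arbitrary. The first relation in a row needs both relations in the row before; the second then
    follows from the first. *)
Lemma gauss_mul_top n k : (k <= n)%N ->
  (1 - Q ^+ k.+1) * gauss Q n k.+1 = (1 - Q ^+ (n - k)) * gauss Q n k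
  /\ (1 - Q ^+ (n.+1 - k)) * gauss Q n.+1 k = (1 - Q ^+ n.+1) * gauss Q n k.
Proof.
elim: n k => [|n IHn] k kn.
  have -> : k = 0%N by lia.
  by rewrite /= subnn expr0 subrr !mul0r mulr0.
have step j : (j <= n.+1)%N ->
    (1 - Q ^+ j.+1) * gauss Q n.+1 j.+1 = (1 - Q ^+ (n.+1 - j)) * gauss Q n.+1 j.
  rewrite leq_eqVlt => /predU1P[->|jn].
    by rewrite gauss_small // subnn expr0 subrr mulr0 mul0r.
  have [H1 H2] := IHn _ jn.
  rewrite H2 gaussS mulrDr mulrCA H1.
  have -> : Q ^+ n.+1 = Q ^+ j.+1 * Q ^+ (n - j) by rewrite -exprD; congr (_ ^+ _); lia.
  ring.
split; first exact: step.
case: k kn => [|k] kn; first by rewrite !gauss0 subn0.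
rewrite gaussS mulrDr mulrCA subSS -(step k) ?(ltnW kn) //.
have -> : Q ^+ n.+2 = Q ^+ k.+1 * Q ^+ (n.+1 - k).
  by rewrite -exprD; congr (_ ^+ _); lia.
ring.
Qed.

(** The mirror q-Pascal rule: its difference from [gaussS] is the first relation of
    [gauss_mul_top]. *)
Lemma gaussS' n k :
  gauss Q n.+1 k.+1 = Q ^+ (n - k) * gauss Q n k + gauss Q n k.+1.
Proof.
have [kn|nk] := leqP k n; last by rewrite !gauss_small ?mulr0 ?addr0 //; lia.
have [H _] := gauss_mul_top kn.
rewrite gaussS; apply/eqP; rewrite -subr_eq0; apply/eqP.
transitivity ((1 - Q ^+ (n - k)) * gauss Q n k - (1 - Q ^+ k.+1) * gauss Q n k.+1).
  by ring.
by rewrite H subrr.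
Qed.

(** Chains the two relations of [gauss_mul_top]; later it is the source of the Appell recurrence for
    sums with Gaussian coefficients. *)
Lemma gauss_absorb n k :
  (1 - Q ^+ k.+1) * gauss Q n.+1 k.+1 = (1 - Q ^+ n.+1) * gauss Q n k.
Proof.
have [kn|nk] := leqP k n; last by rewrite !gauss_small ?mulr0 //; lia.
have [_ <-] := gauss_mul_top kn.
by have [<- _] := @gauss_mul_top n.+1 k (leqW kn).
Qed.

(** Identifies the recursive [gauss] with the Pochhammer quotient of [qbin], without dividing. *)
Lemma gauss_prod n k (poch := fun m => \prod_(i < m) (1 - Q * Q ^+ i)) : (k <= n)%N ->
  gauss Q n k * (poch k * poch (n - k)%N) = poch n.
Proof.
have pochS m : poch m.+1 = poch m * (1 - Q ^+ m.+1).
  by rewrite /poch big_ord_recr /= exprS.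
have poch0 : poch 0 = 1 by rewrite /poch big_ord0.
elim: n k => [|n IHn] [|k] // kn; rewrite ?gauss0 ?subn0 ?poch0 ?mul1r //.
rewrite subSS !pochS -(IHn k) //.
transitivity ((1 - Q ^+ k.+1) * gauss Q n.+1 k.+1 * (poch k * poch (n - k)%N)).
  by ring.
by rewrite gauss_absorb; ring.
Qed.

End Gauss.

Section GMaj.
Variables (T : Type) (x0 : T) (gt : rel T).

(** The descent relation is a parameter because descents are also counted in words containing the
    extra symbol [None]. *)
Definition gmaj (w : seq T) : nat :=
  (\sum_(0 <= i < (size w).-1) i.+1 * gt (nth x0 w i) (nth x0 w i.+1))%N.

Lemma gmaj_rcons2 w x y :
  gmaj (rcons (rcons w x) y) = (gmaj (rcons w x) + (size w).+1 * gt x y)%N.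
Proof.
rewrite /gmaj !size_rcons /= big_nat_recr //=; congr (_ + _ * gt _ _)%N.
- apply: eq_big_nat => i /andP[_ iw].
  by congr (_ * gt _ _)%N; rewrite nth_rcons size_rcons ?ltnS ?iw ?(ltnW iw).
- by rewrite nth_rcons size_rcons ltnS leqnn nth_rcons ltnn eqxx.
- by rewrite nth_rcons size_rcons ltnn eqxx.
Qed.

End GMaj.

Section Shuffle.
Variable X : Type.

(* [shuf w k f] is the sum of [f v] over all shuffles [v] of the word [w] with
   [k] copies of [None]. *)
Fixpoint shuf (R : nmodType) (w : seq X) (k : nat) {struct w} :
    (seq (option X) -> R) -> R :=
  match w with
  | [::] => fun f => f (nseq k None)
  | x :: w' => (fix shufk (k : nat) (f : seq (option X) -> R) {struct k} : R :=
      match k with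
      | 0 => f (map Some w)
      | k'.+1 => shuf w' k (fun v => f (Some x :: v))
                 + shufk k' (fun v => f (None :: v))
      end) k
  end.

Section Theory.
Variable R : nmodType.
Implicit Types f : seq (option X) -> R.

Lemma shuf0 w f : shuf w 0 f = f (map Some w). Proof. by case: w. Qed.

Lemma shuf_nil k f : shuf [::] k f = f (nseq k None). Proof. by []. Qed.

Lemma shuf_cons x w k f :
  shuf (x :: w) k.+1 f =
  shuf w k.+1 (fun v => f (Some x :: v)) + shuf (x :: w) k (fun v => f (None :: v)).
Proof. by []. Qed.

Lemma shuf_ext w k f1 f2 :
  (forall v, size v = (size w + k)%N -> f1 v = f2 v) -> shuf w k f1 = shuf w k f2.
Proof.
elim: w k f1 f2 => [|x w IHw] k f1 f2 ef.
  by apply: ef; rewrite size_nseq.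
elim: k f1 f2 ef => [|k IHk] f1 f2 ef.
  by rewrite !shuf0; apply: ef; rewrite size_map addn0.
rewrite !shuf_cons; congr (_ + _).
  by apply: IHw => v sv; apply: ef; rewrite /= sv.
by apply: IHk => v sv; apply: ef; rewrite /= sv addnS.
Qed.

(** [shuf] peels letters off the front, whereas the major index is easy to follow only when letters
    are appended; hence the same recursion at the right end. *)
Lemma shuf_rcons x w k f :
  shuf (rcons w x) k.+1 f =
  shuf w k.+1 (fun v => f (rcons v (Some x)))
  + shuf (rcons w x) k (fun v => f (rcons v None)).
Proof.
elim: w k f => [|y w IHw] k f.
  rewrite -[rcons [::] x]/[:: x].
  elim: k f => [|k IHk] f; first by rewrite /= addrC.
  rewrite [LHS]shuf_cons IHk [in RHS]shuf_cons !shuf_nil addrCA; congr (_ + (f _ + _)).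
  by rewrite -cats1 cat_cons -(nseqD _ 1) addn1.
elim: k f => [|k IHk] f.
  rewrite rcons_cons [LHS]shuf_cons IHw [in RHS]shuf_cons !shuf0 addrAC.
  by rewrite -!rcons_cons /= !map_rcons.
rewrite rcons_cons [LHS]shuf_cons IHw IHk [in RHS]shuf_cons addrACA.
by congr (_ + _).
Qed.

End Theory.

Lemma shufZ (R : comNzRingType) w k (c : R) f :
  shuf w k (fun v => c * f v) = c * shuf w k f.
Proof.
elim: w k f => [|x w IHw] k f //.
elim: k f => [|k IHk] f; first by rewrite !shuf0.
by rewrite !shuf_cons IHw IHk mulrDr.
Qed.

Variables (x0 : X) (gt : rel X) (big : pred X).

(** [None] enters the order just below the [big] letters and above all others. *)
Definition ogt (a b : option X) : bool :=
  match a, b with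
  | Some x, Some y => gt x y
  | Some x, None => big x
  | None, Some y => ~~ big y
  | None, None => false
  end.

Definition omaj := gmaj None ogt.

Lemma omaj_map w : omaj (map Some w) = gmaj x0 gt w.
Proof.
rewrite /omaj /gmaj size_map; apply: eq_big_nat => i /andP[_ iw].
by rewrite !(nth_map x0) //; lia.
Qed.

Lemma omaj_nseq k : omaj (nseq k None) = 0%N.
Proof.
rewrite /omaj /gmaj big1 // => i _.
by rewrite !nth_nseq !if_same muln0.
Qed.


(** Letters on opposite sides of [None] must compare accordingly. This is asked of consecutive
    letters of a word only, since no other pair becomes adjacent in a shuffle with [None]s. *)
Definition compat (x y : X) : bool :=
  (big x ==> ~~ big y ==> gt x y) && (~~ big x ==> big y ==> ~~ gt x y).

Variables (R : comNzRingType) (Q : R).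

Let lastbig w := last false (map big w).

(* Both sums have product formulas only when sorted by the last entry of the
   shuffle; the two formulas feed each other in the induction. *)
Lemma shuf_omaj_last w :
  (forall k x, sorted compat (rcons w x) ->
     shuf w k (fun v => Q ^+ omaj (rcons v (Some x))) =
     Q ^+ gmaj x0 gt (rcons w x) * (if big x then 1 else Q ^+ k)
       * gauss Q (size w + k) k)
  /\ (forall k, sorted compat w ->
     shuf w k (fun v => Q ^+ omaj (rcons v None)) =
     Q ^+ gmaj x0 gt w * (if lastbig w then Q ^+ size w else 1)
       * gauss Q (size w + k) k).
Proof.
elim/last_ind: w => [|w x [IHA IHB]].
  split=> [k x _|k _]; rewrite shuf_nil gaussnn mulr1.
    have -> : gmaj x0 gt (rcons [::] x) = 0%N by rewrite /gmaj big_nil.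
    case: k => [|k]; first by rewrite /omaj /gmaj big_nil mul1r if_same.
    rewrite -[nseq k.+1 _]/(nseq (1 + k) _) addnC nseqD cats1 /omaj gmaj_rcons2.
    rewrite -cats1 -(nseqD k 1) -/omaj.
    rewrite (omaj_nseq (k + 1)) size_nseq add0n mul1r /=.
    by case: (big x); rewrite ?muln0 ?muln1.
  have -> : rcons (nseq k None) None = nseq (k + 1) (@None X) by rewrite nseqD cats1.
  by rewrite omaj_nseq /gmaj big_nil mulr1.
have sub y : sorted compat (rcons (rcons w x) y) ->
    sorted compat (rcons w x) /\ compat x y.
  case: w {IHA IHB} => [|z w] /=; first by rewrite andbT.
  by rewrite rcons_path last_rcons => /andP[].
have lb : lastbig (rcons w x) = big x by rewrite /lastbig map_rcons last_rcons.
(* This half for [rcons w x] needs only [IHA] and an inner induction on [k]. It comes first because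
   the other half splits on whether the entry before [y] is [x] or [None]. *)
have B k : sorted compat (rcons w x) ->
     shuf (rcons w x) k (fun v => Q ^+ omaj (rcons v None)) =
     Q ^+ gmaj x0 gt (rcons w x) * (if big x then Q ^+ (size w).+1 else 1)
       * gauss Q ((size w).+1 + k) k.
  move=> sw; elim: k => [|k IHk].
    rewrite shuf0 map_rcons /omaj gmaj_rcons2 -map_rcons -/omaj omaj_map gauss0.
    rewrite size_map mulr1 exprD /=.
    by case: (big x); rewrite ?muln1 ?muln0.
  rewrite shuf_rcons.
  rewrite (@shuf_ext _ w k.+1 _ (fun v => Q ^+ (((size w).+1 + k.+1) * big x)
             * Q ^+ omaj (rcons v (Some x)))); last first.
    by move=> v sv; rewrite /omaj gmaj_rcons2 sv -exprD addnC.
  rewrite (@shuf_ext _ (rcons w x) k _ (fun v => Q ^+ omaj (rcons v None))); last first.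
    by move=> v sv; rewrite /omaj gmaj_rcons2 /= muln0 addn0.
  rewrite shufZ IHA // IHk addnS gaussS addnS.
  case: (big x); rewrite ?muln1 ?muln0 ?expr0 ?exprS ?exprD; last by ring.
  ring.
split=> [k y|k sw]; last by rewrite lb size_rcons B.
move/sub => [sw cxy].
case: k => [|k].
  rewrite shuf0 gauss0 mulr1 -map_rcons omaj_map gmaj_rcons2.
  by case: (big y); rewrite ?mulr1.
rewrite shuf_rcons.
rewrite (@shuf_ext _ w k.+1 _ (fun v => Q ^+ (((size w).+1 + k.+1) * gt x y)
           * Q ^+ omaj (rcons v (Some x)))); last first.
  by move=> v sv; rewrite /omaj gmaj_rcons2 sv -exprD addnC.
rewrite (@shuf_ext _ (rcons w x) k _ (fun v => Q ^+ (((size w).+1 + k.+1) * ~~ big y)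
           * Q ^+ omaj (rcons v None))); last first.
  by move=> v sv; rewrite /omaj gmaj_rcons2 sv size_rcons -exprD addnC addnS.
rewrite !shufZ IHA // B // size_rcons gmaj_rcons2 exprD addnS.
have H1 := gaussS Q ((size w).+1 + k) k.
have H2 := gaussS' Q ((size w).+1 + k) k; rewrite addnK in H2.
rewrite !addSnnS in H1 H2 *.
move: H1 H2 cxy; rewrite /compat; set G := gauss Q _.+1 _; move: G => G H1 H2.
(* [compat] rules out the inconsistent cases; each of the others is one of the two q-Pascal
   rules. *)
case: (big x); case: (big y); case: (gt x y) => //= _;
  rewrite ?muln1 ?muln0 ?expr0 ?mul1r ?mulr1; 
  solve [ rewrite H1 !(exprS, exprD); ring | rewrite H2 !(exprS, exprD); ring ].
Qed.

(** Splitting on the last entry of the shuffle gives the two sums of [shuf_omaj_last], which a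
    q-Pascal rule adds up. *)
Lemma shuf_omaj w k : sorted compat w ->
  shuf w k (fun v => Q ^+ omaj v) = Q ^+ gmaj x0 gt w * gauss Q (size w + k) k.
Proof.
case: k => [|k]; first by rewrite shuf0 omaj_map gauss0 mulr1.
elim/last_ind: w => [|w x _] sw.
  by rewrite shuf_nil omaj_nseq /gmaj big_nil gaussnn mulr1.
have [_ B] := shuf_omaj_last (rcons w x).
have [A _] := shuf_omaj_last w.
rewrite shuf_rcons A // B // size_rcons /lastbig map_rcons last_rcons.
have H1 := gaussS Q ((size w).+1 + k) k.
have H2 := gaussS' Q ((size w).+1 + k) k; rewrite addnK in H2.
rewrite !addSnnS in H1 H2 *; rewrite [(_ + k.+2)%N]addnS.
by case: (big x); [rewrite H2 | rewrite H1]; rewrite ?exprS; ring.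
Qed.

End Shuffle.

(** * Inserting a fixed point *)

(** Words are maps over [enum], so this turns inserting a position into inserting one entry in a
    word. *)
Lemma enum_lift n (p : 'I_n.+1) :
  enum 'I_n.+1 = take p [seq lift p i | i <- enum 'I_n]
                 ++ p :: drop p [seq lift p i | i <- enum 'I_n].
Proof.
set E := map _ _.
apply: (inj_map val_inj); rewrite map_cat /= map_take map_drop val_enum_ord.
have -> : map val E = map (bump p) (iota 0 n).
  by rewrite -val_enum_ord -!map_comp.
have pn : (p <= n)%N by rewrite -ltnS.
have -> : iota 0 n = iota 0 p ++ iota p (n - p) by rewrite -iotaD subnKC.
rewrite map_cat take_size_cat ?drop_size_cat ?size_map ?size_iota //.
have -> : iota 0 n.+1 = iota 0 p ++ (p : nat) :: iota p.+1 (n - p).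
  by rewrite -[_ :: _]/(iota p (n - p).+1) -iotaD addnS subnKC.
congr (_ ++ _ :: _).
  rewrite -[LHS]map_id; apply/eq_in_map => i; rewrite mem_iota /bump; lia.
rewrite -[in LHS]add1n iotaDl; apply/eq_in_map => i; rewrite mem_iota /bump; lia.
Qed.

Lemma lift_perm_onto_bij n (i0 j0 : 'I_n.+1) :
  {on [pred s : 'S_n.+1 | s i0 == j0], bijective (@lift_perm n i0 j0)}.
Proof.
pose r (s : 'S_n.+1) (k : 'I_n) : 'I_n := odflt k (unlift j0 (s (lift i0 k))).
have rK (s : 'S_n.+1) k : s i0 = j0 -> lift j0 (r s k) = s (lift i0 k).
  rewrite /r => sij; have := neq_lift i0 k.
  by rewrite -(inj_eq (@perm_inj _ s)) sij => /unlift_some[] ? ? ->.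
(* [perm] needs injectivity for every [s]; off the fibre [s i0 = j0] the map [r s] is replaced by
   the identity. *)
have r_inj (s : 'S_n.+1) : injective (if s i0 == j0 then r s else id).
  case: eqP => [sij j k /(congr1 (lift j0))|_ j k //].
  by rewrite !rK // => /perm_inj/lift_inj.
exists (fun s => perm (@r_inj s)) => [s _ | s /eqP sij].
  by apply/permP => j; rewrite permE lift_perm_id eqxx /r lift_perm_lift liftK.
apply/permP => j; case: (unliftP i0 j) => [k|] ->; last by rewrite lift_perm_id.
by rewrite lift_perm_lift permE sij eqxx rK.
Qed.

Section InsertFixedPoint.
Variables l n : nat.
Implicit Types p : 'I_n.+1.

(** The default [ord0] is the colour of the inserted point: a fixed point has colour exponent 0. *)
Definition insfix p (s : colperm l.+1 n) : colperm l.+1 n.+1 :=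
  (lift_perm p p s.1, [ffun i => oapp s.2 ord0 (unlift p i)]).

Lemma insfix_perm_id p (s : colperm l.+1 n) : (insfix p s).1 p = p.
Proof. exact: lift_perm_id. Qed.

Lemma insfix_perm_lift p (s : colperm l.+1 n) j : (insfix p s).1 (lift p j) = lift p (s.1 j).
Proof. exact: lift_perm_lift. Qed.

Lemma insfix_col_id p (s : colperm l.+1 n) : (insfix p s).2 p = ord0.
Proof. by rewrite ffunE unlift_none. Qed.

Lemma insfix_col_lift p (s : colperm l.+1 n) j : (insfix p s).2 (lift p j) = s.2 j.
Proof. by rewrite ffunE liftK. Qed.

Lemma isfix_insfix_id p (s : colperm l.+1 n) : isfix (insfix p s) p.
Proof. by rewrite /isfix insfix_perm_id insfix_col_id eqxx. Qed.

Lemma isfix_insfix_lift p (s : colperm l.+1 n) j : isfix (insfix p s) (lift p j) = isfix s j.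
Proof.
by rewrite /isfix insfix_perm_lift insfix_col_lift (inj_eq (@lift_inj _ p)).
Qed.

Lemma sum_insfix (V : nmodType) p (P : pred (colperm l.+1 n.+1)) F :
  \sum_(s | P s && isfix s p) F s = \sum_(s | P (insfix p s)) F (insfix p s) :> V.
Proof.
have [g gK1 gK2] := lift_perm_onto_bij p p.
rewrite (reindex (insfix p)); last first.
  exists (fun s : colperm l.+1 n.+1 =>
    (g s.1, [ffun j : 'I_n => s.2 (lift p j)]) : colperm l.+1 n) => [s _ | s].
    rewrite [RHS]surjective_pairing; congr (_, _).
      by rewrite gK1 // inE lift_perm_id.
    by apply/ffunP => j; rewrite ffunE insfix_col_lift.
  rewrite inE => /andP[_ /andP[sp /eqP cp]].
  rewrite [RHS]surjective_pairing; congr (_, _); first exact: gK2.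
  apply/ffunP => j; case: (unliftP p j) => [k|] ->; last first.
    by rewrite insfix_col_id; apply: val_inj.
  by rewrite insfix_col_lift ffunE.
by apply: eq_bigl => s; rewrite isfix_insfix_id andbT.
Qed.

Lemma lift_ltp p (j : 'I_n) : (lift p j < p)%N = (j < p)%N.
Proof. by rewrite /= /bump; lia. Qed.

(** Passing from [m] to [m.+1] frees exactly the position [n - m] (counted from 0). If it is fixed,
    it is the first fixed point, and deleting it leaves an element of size [n] with the same [m]. *)
Lemma sum_inGmS (V : nmodType) m (F : colperm l.+1 n.+1 -> V) : (m <= n)%N ->
  \sum_(s | inGm m.+1 s) F s =
  \sum_(s | inGm m s) F s + \sum_(s : colperm l.+1 n | inGm m s) F (insfix (inord (n - m)) s).
Proof.
move=> mn; pose p : 'I_n.+1 := inord (n - m).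
have pE : p = (n - m)%N :> nat by rewrite inordK // ltnS leq_subr.
rewrite (bigID (fun s => isfix s p)) [LHS]addrC /= sum_insfix; congr (_ + _).
  apply: eq_bigl => s; apply/andP/forallP => [[/forallP Gs sp] i|Gs].
    apply/implyP; rewrite subSn // ltnS leq_eqVlt => /predU1P[ip|ip].
      by have -> : i = p by apply: val_inj; rewrite /= ip -pE.
    by apply: (implyP (Gs i)); rewrite subSS.
  split; last by apply: (implyP (Gs p)); rewrite pE subSn.
  apply/forallP => i; apply/implyP; rewrite subSS => ip.
  by apply: (implyP (Gs i)); rewrite subSn // ltnS ltnW.
apply: eq_bigl => s; apply/forallP/forallP => Gs i.
  rewrite -pE -(lift_ltp p) -(isfix_insfix_lift p).
  by have := Gs (lift p i); rewrite subSS -pE.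
rewrite subSS -pE; case: (unliftP p i) => [j|] ->; last by rewrite ltnn.
by rewrite lift_ltp isfix_insfix_lift pE.
Qed.

Lemma nonfix_insfix p (s : colperm l.+1 n) :
  [seq i <- enum 'I_n.+1 | ~~ isfix (insfix p s) i] =
  [seq lift p i | i <- enum 'I_n & ~~ isfix s i].
Proof.
rewrite (enum_lift p) filter_cat /= isfix_insfix_id -filter_cat cat_take_drop.
by rewrite filter_map; congr map; apply: eq_filter => i; rewrite /= isfix_insfix_lift.
Qed.

Lemma FIXs_insfix p (s : colperm l.+1 n) : (forall i : 'I_n, (i < p)%N -> ~~ isfix s i) ->
  FIXs (insfix p s) = p.+1 :: map S (FIXs s).
Proof.
move=> sp; rewrite /FIXs (enum_lift p) filter_cat /= isfix_insfix_id.
set E := [seq lift p i | i <- enum 'I_n].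
have nofix : [seq i <- take p E | isfix (insfix p s) i] = [::].
  rewrite (@eq_in_filter _ _ pred0) ?filter_pred0 // => i /(nthP p) [k].
  rewrite size_takel => [kp|]; last by rewrite size_map size_enum_ord -ltnS.
  have kn : (k < n)%N by rewrite (leq_trans kp) // -ltnS.
  rewrite nth_take // (nth_map (Ordinal kn)) ?size_enum_ord // => <-.
  by rewrite isfix_insfix_lift; apply/negbTE/sp; rewrite nth_enum_ord.
rewrite nofix /= -map_comp; congr (_ :: _).
have -> : [seq i <- drop p E | isfix (insfix p s) i] = [seq i <- E | isfix (insfix p s) i].
  by rewrite -[in RHS](cat_take_drop p E) filter_cat nofix.
rewrite filter_map -map_comp (eq_filter (fun i => isfix_insfix_lift p s i)).
apply/eq_in_map => i; rewrite mem_filter => /andP[fi _] /=.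
congr _.+1; rewrite /bump; case: (leqP p i) => // ip.
by have := sp i ip; rewrite fi.
Qed.

Lemma col_insfix p (s : colperm l.+1 n) : Defs.col (insfix p s) = Defs.col s.
Proof.
have sumE k (c : 'I_k -> nat) : (\sum_(i < k) c i)%N = sumn [seq c i | i <- enum 'I_k].
  by rewrite sumnE big_map big_enum.
rewrite /Defs.col !sumE (enum_lift p) map_cat sumn_cat /= insfix_col_id add0n.
rewrite -sumn_cat -map_cat cat_take_drop -map_comp; congr sumn.
by apply: eq_map => i /=; rewrite insfix_col_lift.
Qed.

End InsertFixedPoint.

(** * Descents and fixed points *)

Definition letter_at l n (s : colperm l n) (i : 'I_n) : letter :=
  (nat_of_ord (s.2 i), (s.1 i).+1).

(** At a non-fixed [i] this is the letter of [Der s] coming from [i], the count giving its rank; the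
    value at fixed points is discarded by [wachs]. *)
Definition derletter l n (s : colperm l n) (i : 'I_n) : letter :=
  (nat_of_ord (s.2 i),
   (count (fun b => b < (s.1 i).+1)%N
      [seq (s.1 j).+1 | j <- enum 'I_n & ~~ isfix s j]).+1).

Definition excedes l n (s : colperm l n) (i : 'I_n) : bool :=
  (nat_of_ord (s.2 i) == 0%N) && (i < s.1 i)%N.

Definition der_excs l n (s : colperm l n) : seq (letter * bool) :=
  [seq (derletter s i, excedes s i) | i <- enum 'I_n & ~~ isfix s i].

(* Fixed points are blurred into [None]; by Wachs, the remaining letters together
   with their excedance bits still determine the descents, see [omaj_wachs]. *)
Definition wachs l n (s : colperm l n) : seq (option (letter * bool)) :=
  [seq if isfix s i then None else Some (derletter s i, excedes s i)
    | i <- enum 'I_n].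

(** Excedances are declared greater than all other letters, so that [compat] holds for every pair;
    on adjacent positions of an actual word this agrees with the letter order. *)
Definition wachs_gt (x y : letter * bool) : bool :=
  if x.2 == y.2 then letter_lt y.1 x.1 else x.2.

Lemma compat_wachs_gt x y : compat wachs_gt snd x y.
Proof. by case: x y => [x []] [y []]. Qed.

(** Strictness comes from [a] itself, which is counted below [b] but not below [a]. *)
Lemma count_lt_lt (z : seq nat) a b : a \in z ->
  (count (fun c => c < a)%N z < count (fun c => c < b)%N z)%N = (a < b)%N.
Proof.
move=> az; apply/idP/idP => [|ab].
  apply: contraTT; rewrite -!leqNgt => ba; apply: sub_count => c /= cb.
  exact: leq_trans cb ba.
have -> : count (fun c => c < b)%N z =
    (count (fun c => c < a)%N z + count (fun c => a <= c < b)%N z)%N.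
  rewrite -count_predUI [X in (_ + X)%N](@eq_count _ _ pred0).
    by rewrite count_pred0 addn0; apply: eq_count => c /=; lia.
  by move=> c /=; lia.
by rewrite -[X in (X < _)%N]addn0 ltn_add2l -has_count; apply/hasP; exists a; rewrite ?leqnn.
Qed.

Section Words.
Variables l n : nat.
Implicit Types s : colperm l n.

Lemma DerE s : Der s = map fst (der_excs s).
Proof. by rewrite /Der /der_excs -!map_comp. Qed.

Lemma size_der_excs s : inGm 0 s -> size (der_excs s) = n.
Proof.
move=> /forallP Ds; rewrite size_map (@eq_filter _ _ predT) ?filter_predT ?size_enum_ord //.
by move=> i; have := Ds i; rewrite subn0 ltn_ord.
Qed.

Lemma wachs_inGm0 s : inGm 0 s -> wachs s = map Some (der_excs s).
Proof.
move=> /forallP Ds; rewrite /wachs /der_excs.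
have nf i : isfix s i = false by apply/negbTE; have := Ds i; rewrite subn0 ltn_ord.
rewrite (@eq_filter _ _ predT) ?filter_predT -?map_comp => [|i]; last by rewrite /= nf.
by apply: eq_map => i; rewrite /= nf.
Qed.

Lemma letter_lt_derletter s i j : ~~ isfix s i -> ~~ isfix s j ->
  letter_lt (derletter s j) (derletter s i) = letter_lt (letter_at s j) (letter_at s i).
Proof.
move=> si sj; rewrite /letter_lt /= ltnS count_lt_lt //.
by apply/mapP; exists j; rewrite // mem_filter sj mem_enum.
Qed.

(** The positions [i] and [j = i + 1] leave no room between them: among letters of colour 0, an
    excedance at [i] has value at least [j], and a non-fixed non-excedance at [j] has value at most
    [i]. Injectivity settles the ties, and nonzero colours lie below everything of colour 0. *)
Lemma wachs_gt_next s (i j : 'I_n) : j = i.+1 :> nat ->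
  ogt wachs_gt snd (if isfix s i then None else Some (derletter s i, excedes s i))
    (if isfix s j then None else Some (derletter s j, excedes s j))
  = letter_lt (letter_at s j) (letter_at s i).
Proof.
move=> ji; have ij : s.1 i != s.1 j :> nat.
  by apply/eqP => /val_inj /perm_inj e; move: ji; rewrite e; lia.
case: ifP => [|/negbT] fi; case: ifP => [|/negbT] fj;
  rewrite /ogt /wachs_gt /= ?letter_lt_derletter //;
  move: fi fj ij; rewrite /isfix /excedes /letter_lt /= -!(inj_eq val_inj) /=;
  case: (s.2 i) (s.2 j) => [ci _] [cj _] /=; try lia.
by case: ci cj => [|ci] [|cj] /=; case: (ltnP i (s.1 i)); case: (ltnP j (s.1 j)) => /=; lia.
Qed.

Lemma omaj_wachs s : omaj wachs_gt snd (wachs s) = maj (cword s).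
Proof.
rewrite /omaj /gmaj /maj [size (wachs s)]size_map [size (cword s)]size_map size_enum_ord.
rewrite /wachs /cword.
apply: eq_big_nat => i /andP[_ iN].
have i1 : (i.+1 < n)%N by lia.
have i0 : (i < n)%N by lia.
pose oi := Ordinal i0; pose oj := Ordinal i1.
rewrite !(nth_map oi None, nth_map oi (0%N, 0%N)) ?size_enum_ord //.
have -> : nth oi (enum 'I_n) i = oi by apply: val_inj; rewrite /= nth_enum_ord.
have -> : nth oi (enum 'I_n) i.+1 = oj by apply: val_inj; rewrite /= nth_enum_ord.
by rewrite (@wachs_gt_next s oi oj).
Qed.

Lemma maj_Der s : inGm 0 s -> maj (Der s) = maj (cword s).
Proof.
move=> Ds; have /forallP Ds' := Ds.
have nf i : ~~ isfix s i by have := Ds' i; rewrite subn0 ltn_ord.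
rewrite DerE /der_excs -map_comp (@eq_filter _ _ predT) ?filter_predT => [|i]; last first.
  by rewrite /= nf.
rewrite /maj [size (cword s)]size_map size_map size_enum_ord /cword.
apply: eq_big_nat => i /andP[_ iN].
have i1 : (i.+1 < n)%N by lia.
have i0 : (i < n)%N by lia.
by rewrite !(nth_map (Ordinal i0) (0%N, 0%N)) ?size_enum_ord //= letter_lt_derletter.
Qed.

(** Without fixed points the blurred word contains no [None], so the modified order yields the true
    major index. *)
Lemma gmaj_der_excs x0 s : inGm 0 s -> gmaj x0 wachs_gt (der_excs s) = maj (Der s).
Proof.
by move=> Ds; rewrite maj_Der // -omaj_wachs wachs_inGm0 // (omaj_map x0).
Qed.

End Words.

Section WordsInsert.
Variables l n : nat.
Implicit Types p : 'I_n.+1.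

Lemma excedes_insfix p (s : colperm l.+1 n) j :
  excedes (insfix p s) (lift p j) = excedes s j.
Proof.
rewrite /excedes insfix_perm_lift insfix_col_lift; congr (_ && _).
by rewrite /= /bump; lia.
Qed.

Lemma derletter_insfix p (s : colperm l.+1 n) j :
  derletter (insfix p s) (lift p j) = derletter s j.
Proof.
rewrite /derletter insfix_perm_lift insfix_col_lift nonfix_insfix.
rewrite -map_comp !count_map; congr (_, _.+1); apply: eq_count => i.
by rewrite /= insfix_perm_lift /= /bump; lia.
Qed.

Lemma der_excs_insfix p (s : colperm l.+1 n) : der_excs (insfix p s) = der_excs s.
Proof.
rewrite /der_excs nonfix_insfix -map_comp; apply: eq_map => i /=.
by rewrite derletter_insfix excedes_insfix.
Qed.

Lemma wachs_insfix p (s : colperm l.+1 n) :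
  wachs (insfix p s) = take p (wachs s) ++ None :: drop p (wachs s).
Proof.
rewrite {1}/wachs (enum_lift p) map_cat /= isfix_insfix_id map_take map_drop -map_comp.
set w := map _ _; have -> // : w = wachs s.
by apply: eq_map => i /=; rewrite isfix_insfix_lift derletter_insfix excedes_insfix.
Qed.

Lemma fixn_insfix p (s : colperm l.+1 n) :
  (forall i : 'I_n, (i < p)%N -> ~~ isfix s i) -> fixn (insfix p s) = (fixn s).+1.
Proof. by move=> sp; rewrite /fixn FIXs_insfix //= size_map. Qed.

(** The new first fixed point contributes [p] to [maf]; for each later one both the position and the
    index grow by 1, and [Der] and the colours are unchanged. *)
Lemma fmaf_insfix p (s : colperm l.+1 n) :
  (forall i : 'I_n, (i < p)%N -> ~~ isfix s i) ->
  fmaf (insfix p s) = (fmaf s + l.+1 * p)%N.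
Proof.
move=> sp; rewrite /fmaf /maf col_insfix !DerE der_excs_insfix FIXs_insfix //=.
rewrite size_map big_ord_recl /=.
rewrite (eq_bigr (fun j : 'I_(size (FIXs s)) => nth 0 (FIXs s) j - j.+1)%N) => [|j _].
  by rewrite subSS subn0 addnCA mulnDr; lia.
by rewrite /bump leq0n add0n add1n (nth_map 0%N) ?subSS.
Qed.

End WordsInsert.

(** * Summation over shuffles of derangement words *)

Section DerangementSums.
Variables (R : comNzRingType) (q : R) (l : nat).

(** Keeping [h] abstract lets the induction in [sum_wachs] rewrite the summand word by word. *)
Definition der_sum n (h : seq (letter * bool) -> R) : R :=
  \sum_(s : colperm l.+1 n | inGm 0 s) q ^+ Defs.col s * h (der_excs s).

Lemma der_sum_ext n h1 h2 :
  (forall w, size w = n -> h1 w = h2 w) -> der_sum n h1 = der_sum n h2.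
Proof. by move=> eh; apply: eq_bigr => s Ds; rewrite eh // size_der_excs. Qed.

Lemma der_sumD n h1 h2 :
  der_sum n (fun w => h1 w + h2 w) = der_sum n h1 + der_sum n h2.
Proof. by rewrite -big_split; apply: eq_bigr => s _; rewrite mulrDr. Qed.

(** The first [n - m] entries are not fixed, and the rest form a shuffle with [None]s. Splitting on
    whether position [n - m] is fixed, as in [sum_inGmS], matches the recursion of [shuf]. *)
Lemma sum_wachs n m (f : seq (option (letter * bool)) -> R) : (m <= n)%N ->
  \sum_(s : colperm l.+1 n | inGm m s) q ^+ Defs.col s * f (wachs s) =
  \sum_(k < m.+1) der_sum (n - k) (fun w => shuf (drop (n - m) w) k
     (fun v => f (map Some (take (n - m) w) ++ v))).
Proof.
elim: m n f => [|m IHm] n f mn.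
  rewrite big_ord1 /= subn0; apply: eq_bigr => s Ds.
  rewrite drop_oversize ?take_oversize ?size_der_excs //.
  by rewrite shuf_nil cats0 wachs_inGm0.
case: n mn => // n; rewrite ltnS => mn.
rewrite sum_inGmS // (IHm _ _ (leqW mn)).
have -> : \sum_(s : colperm l.+1 n | inGm m s)
    q ^+ Defs.col (insfix (inord (n - m)) s) * f (wachs (insfix (inord (n - m)) s)) =
  \sum_(s : colperm l.+1 n | inGm m s)
    q ^+ Defs.col s * f (take (n - m) (wachs s) ++ None :: drop (n - m) (wachs s)).
  by apply: eq_bigr => s _; rewrite col_insfix wachs_insfix inordK // ltnS leq_subr.
rewrite (IHm n (fun v => f (take (n - m) v ++ None :: drop (n - m) v))) //.
rewrite [in RHS]big_ord_recl [X in X + _ = _]big_ord_recl /= subn0 -addrA; congr (_ + _).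
  apply: der_sum_ext => w sw; rewrite subSS !shuf0 -!map_cat.
  by rewrite !cat_take_drop.
pose C k w := shuf (drop (n - m) w) k (fun v => f (map Some (take (n - m) w) ++ None :: v)).
(* For [k = m] no letter is left after the first [n - m], so no shuffle starts with a letter; the
   [if] pads that sum with 0. *)
transitivity (\sum_(k < m.+1) ((if (k < m)%N then der_sum (n - k) (fun w =>
      shuf (drop (n.+1 - m) w) k.+1 (fun v => f (map Some (take (n.+1 - m) w) ++ v)))
      else 0) + der_sum (n - k) (C k))).
  rewrite big_split /= [X in _ = X + _]big_ord_recr /= ltnn addr0.
  congr (_ + _); first by apply: eq_bigr => k _; rewrite ltn_ord.
  apply: eq_bigr => k _; apply: der_sum_ext => w sw; apply: shuf_ext => v _.
  have st : size (map Some (take (n - m) w)) = (n - m)%N.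
    by rewrite size_map size_takel // sw; have := ltn_ord k; lia.
  by rewrite -{1}st take_size_cat // -{2}st drop_size_cat.
apply: eq_bigr => k _; rewrite !subSS; have km : (k <= m)%N by rewrite -ltnS.
case: ltnP => mk.
  rewrite -der_sumD; apply: der_sum_ext => w sw.
  have pw : (n - m < size w)%N by rewrite sw; lia.
  have [x _] : exists x : letter * bool, true by case: w {sw} pw => // x; exists x.
  rewrite subSn // (drop_nth x pw) (take_nth x pw) shuf_cons /C (drop_nth x pw).
  by congr (_ + _); apply: shuf_ext => v _; rewrite map_rcons cat_rcons.
rewrite add0r; apply: der_sum_ext => w sw; rewrite /C.
by rewrite drop_oversize ?sw //; lia.
Qed.

Lemma sum_maj_der n (Q : R) :
  \sum_(s : colperm l.+1 n) q ^+ Defs.col s * Q ^+ maj (cword s) =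
  \sum_(k < n.+1) gauss Q n k *
    \sum_(s : colperm l.+1 (n - k) | inGm 0 s) q ^+ Defs.col s * Q ^+ maj (Der s).
Proof.
transitivity (\sum_(s : colperm l.+1 n | inGm n s)
    q ^+ Defs.col s * Q ^+ omaj wachs_gt snd (wachs s)).
  apply: eq_big => [s|s _]; last by rewrite omaj_wachs.
  by symmetry; apply/forallP => i; rewrite subnn.
rewrite (@sum_wachs n n (fun v => Q ^+ omaj wachs_gt snd v)) // subnn.
apply: eq_bigr => k _; rewrite big_distrr /=; apply: eq_bigr => s Ds.
have cs : sorted (compat wachs_gt snd) (der_excs s).
  by case: (der_excs s) => //= x w; elim: w x => //= y w IH x; rewrite compat_wachs_gt IH.
rewrite drop0 take0 /= (shuf_omaj ((0%N, 0%N), false)) // gmaj_der_excs //.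
by rewrite size_der_excs // subnK -1?ltnS // mulrA mulrC.
Qed.

End DerangementSums.

(** * MacMahon's theorem *)

Section MacMahon.
Variables (R : comNzRingType) (Q : R).

Lemma letter_lt_irr x : letter_lt x x = false.
Proof. by rewrite /letter_lt !ltnn andbF. Qed.

Lemma letter_lt_trans : transitive letter_lt.
Proof. by move=> y x z; rewrite /letter_lt; lia. Qed.

Lemma letter_lt_total x y : x != y -> ~~ letter_lt x y -> letter_lt y x.
Proof. by case: x y => [a b] [c d]; rewrite /letter_lt xpair_eqE /=; lia. Qed.

(** The exponents are a rearrangement of the window from [E] to [E + N - 1]: those below [E] are
    moved up by [N]. *)
Lemma sum_Q_rot N E : (E <= N)%N ->
  \sum_(i < N) Q ^+ (N * (i < E) + i) = Q ^+ E * \sum_(i < N) Q ^+ i.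
Proof.
elim: E => [|E IHE] EN.
  by rewrite mul1r; apply: eq_bigr => i _; rewrite muln0.
pose oE := Ordinal EN.
have := IHE (ltnW EN); rewrite (bigD1 oE) //= ltnn muln0 add0n.
rewrite [in X in _ -> X](bigD1 oE) //= ltnSn muln1.
rewrite (eq_bigr (fun i : 'I_N => Q ^+ (N * (i < E.+1) + i))); last first.
  by move=> i iE; rewrite ltnS [(i <= E)%N]leq_eqVlt [_ == _ :> nat](negbTE iE).
set G := \sum_(i < N) Q ^+ i; set S := \sum_(_ | _) _ => H.
have -> : S = Q ^+ E * G - Q ^+ E by rewrite -H; ring.
have QN : Q ^+ N = 1 + (Q - 1) * G by rewrite -subrX1; ring.
by rewrite exprD QN exprS; ring.
Qed.

Definition above n (r : 'I_n -> letter) (x : letter) : nat :=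
  #|[pred a | letter_lt x (r a)]|.

Lemma above_le n (r : 'I_n -> letter) x y :
  ~~ letter_lt x y -> (above r x <= above r y)%N.
Proof.
move=> nxy; apply/subset_leq_card/subsetP => a; rewrite !inE => xa.
case: (eqVneq x y) nxy xa => [->//|xy] nxy.
exact: letter_lt_trans (letter_lt_total xy nxy).
Qed.

Lemma above_lt n (r : 'I_n -> letter) x i :
  letter_lt x (r i) -> (above r (r i) < above r x)%N.
Proof.
move=> xi; apply/proper_card/properP; split.
  by apply/subsetP => a; rewrite !inE; exact: letter_lt_trans.
by exists i; rewrite !inE ?letter_lt_irr.
Qed.

Lemma above_lift n (r : 'I_n.+1 -> letter) j :
  above r (r j) = above (r \o lift j) (r j).
Proof.
rewrite /above -!sum1_card !big_mkcond /= (bigD1_ord j) //= inE letter_lt_irr add0n.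
by rewrite [RHS]big_mkcond.
Qed.

(** For distinct letters the ranks from the top are a permutation of 0, ..., n-1. *)
Lemma sum_above n (r : 'I_n -> letter) (F : nat -> R) : injective r ->
  \sum_(i < n) F (above r (r i)) = \sum_(i < n) F i.
Proof.
move=> r_inj; have e_lt (i : 'I_n) : (above r (r i) < n)%N.
  rewrite -[n in X in (_ < X)%N]card_ord; apply/proper_card/properP.
  by split; [apply/subsetP | exists i; rewrite !inE ?letter_lt_irr].
pose e i : 'I_n := Ordinal (e_lt i).
have e_inj : injective e.
  move=> i k /(congr1 val) /= eik; apply: r_inj; apply/eqP; apply/negPn/negP => ik.
  case: (boolP (letter_lt (r i) (r k))) => [/above_lt|/(letter_lt_total ik)/above_lt];
    by rewrite eik ltnn.
by rewrite [RHS](reindex e) //; apply: onW_bij; exact: injF_bij.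
Qed.

(** MacMahon's product refined by the last letter, so that an induction can tell whether appending a
    letter creates a descent. *)
Lemma sum_last_letter n (r : 'I_n.+1 -> letter) : injective r -> forall j,
  \sum_(s : 'S_n.+1 | s ord_max == j) Q ^+ maj [seq r (s i) | i <- enum 'I_n.+1]
  = Q ^+ above r (r j) * \prod_(1 <= k < n.+1) \sum_(i < k) Q ^+ i.
Proof.
elim: n r => [|n IHn] r r_inj j; rewrite (reindex _ (lift_perm_onto_bij _ _)) /=;
  under eq_bigl => s do rewrite lift_perm_id eqxx;
  under eq_bigr => s _ do rewrite enum_ordSr map_rcons lift_perm_id -map_comp.
  rewrite big_nil mulr1 above_lift /above eq_card0 => [|[]//].
  rewrite (big_pred1 1%g) => [|s]; last by apply/esym/eqP/permP => -[].
  by rewrite (size0nil (size_enum_ord 0)) /maj big_nil.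
pose r' := r \o lift j.
have r'_inj : injective r' by apply: inj_comp r_inj (@lift_inj _ j).
rewrite (partition_big (fun s : 'S_n.+1 => s ord_max) predT) //=.
(* Here [i] indexes the penultimate letter: it exceeds the last one exactly when fewer letters lie
   above it, and that descent adds [n.+1]. The sum is then a window as in [sum_Q_rot]. *)
transitivity (\sum_(i < n.+1)
    Q ^+ (n.+1 * (above r' (r' i) < above r (r j)) + above r' (r' i))
              * \prod_(1 <= k < n.+1) \sum_(i < k) Q ^+ i).
  apply: eq_bigr => i _; rewrite exprD -mulrA -(IHn r' r'_inj i) big_distrr /=.
  apply: eq_bigr => s /eqP si; rewrite -exprD; congr (Q ^+ _).
  have -> : [seq r (lift_perm ord_max j s (widen_ord (leqnSn n.+1) a)) | a <- enum 'I_n.+1]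
            = [seq r' (s a) | a <- enum 'I_n.+1].
    apply: eq_map => a; rewrite /r' /= -(lift_perm_lift ord_max); congr (r (_ _)).
    by apply: val_inj; rewrite /= /bump leqNgt ltn_ord.
  rewrite enum_ordSr map_rcons si.
  have -> : maj = gmaj (0%N, 0%N) (fun x y => letter_lt y x) by [].
  rewrite gmaj_rcons2 2!size_map size_enum_ord addnC; congr (_ * _ + _)%N.
  rewrite (above_lift r j) -/r'; case: (boolP (letter_lt (r j) (r' i))) => [/above_lt->//|].
  by move=> nji; rewrite ltnNge above_le.
rewrite -big_distrl (sum_above (fun i => Q ^+ (n.+1 * (i < above r (r j)) + i))) //=.
rewrite sum_Q_rot; last first.
  by rewrite (above_lift r j) -[X in (_ <= X)%N]card_ord max_card.
by rewrite /= -mulrA; congr (_ * _); rewrite [RHS]big_nat_recr //= mulrC.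
Qed.

Lemma sum_maj_rearrangements n (r : 'I_n -> letter) : injective r ->
  \sum_(s : 'S_n) Q ^+ maj [seq r (s i) | i <- enum 'I_n]
  = \prod_(1 <= k < n.+1) \sum_(i < k) Q ^+ i.
Proof.
case: n r => [|n] r r_inj.
  rewrite (big_pred1 1%g) => [|s]; last by apply/esym/eqP/permP => -[].
  by rewrite (size0nil (size_enum_ord 0)) /maj !big_nil.
rewrite (partition_big (fun s : 'S_n.+1 => s ord_max) predT) //=.
under eq_bigr => j _ do rewrite sum_last_letter //.
by rewrite -big_distrl (sum_above (fun i => Q ^+ i)) //= [RHS]big_nat_recr //= mulrC.
Qed.

End MacMahon.

Lemma sum_exp_mul (R : comNzRingType) (q : R) l k :
  \sum_(i < k * l) q ^+ i = (\sum_(i < l) q ^+ i) * \sum_(i < k) (q ^+ l) ^+ i.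
Proof.
elim: k => [|k IHk]; first by rewrite !big_ord0 mulr0.
rewrite mulSn big_split_ord [in RHS]big_ord_recl mulrDr mulr1; congr (_ + _).
rewrite (eq_bigr (fun i : 'I_(k * l) => q ^+ l * q ^+ i)) => [|i _]; last exact: exprD.
rewrite -big_distrr /= IHk mulrCA big_distrr; congr (_ * _).
by apply: eq_bigr => i _; rewrite /= -exprS.
Qed.

(** For each colouring of the values, MacMahon's theorem in base [q ^+ l.+1] gives the same product;
    the [n] free colours each contribute a further q-integer, merged in by [sum_exp_mul]. *)
Lemma sum_fmaj (R : comNzRingType) (q : R) l n :
  \sum_(s : colperm l.+1 n) q ^+ Defs.col s * (q ^+ l.+1) ^+ maj (cword s) =
  \prod_(1 <= k < n.+1) \sum_(i < k * l.+1) q ^+ i.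
Proof.
rewrite -(pair_bigA _ (fun (p : 'S_n) (c : {ffun 'I_n -> 'I_l.+1}) =>
  q ^+ Defs.col ((p, c) : colperm _ _)
  * (q ^+ l.+1) ^+ maj (cword ((p, c) : colperm _ _)))) /=.
pose by_value (p : 'S_n) (d : {ffun 'I_n -> 'I_l.+1}) := [ffun i => d (p i)].
have by_value_bij p : bijective (by_value p).
  by exists (by_value p^-1%g) => d; apply/ffunP => i; rewrite !ffunE ?permK ?permKV.
(* Once colours are attached to values rather than positions, the colour weight
   and the set of letters no longer depend on the permutation. *)
transitivity (\sum_(p : 'S_n) \sum_(d : {ffun 'I_n -> 'I_l.+1})
    (\prod_(i < n) q ^+ d i)
    * (q ^+ l.+1) ^+ maj [seq (nat_of_ord (d (p i)), (p i).+1) | i <- enum 'I_n]).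
  apply: eq_bigr => p _; rewrite (reindex (by_value p)) /=; last exact: onW_bij.
  apply: eq_bigr => d _; congr (_ * _ ^+ maj _).
    rewrite /Defs.col /= (big_morph _ (exprD q) (expr0 q)).
    rewrite [RHS](reindex_inj (@perm_inj _ p)) /=.
    by apply: eq_bigr => i _; rewrite ffunE.
  by rewrite /cword /=; apply: eq_map => i; rewrite ffunE.
rewrite exchange_big /=.
transitivity (\sum_(d : {ffun 'I_n -> 'I_l.+1}) (\prod_(i < n) q ^+ d i)
    * \prod_(1 <= k < n.+1) \sum_(i < k) (q ^+ l.+1) ^+ i).
  apply: eq_bigr => d _; rewrite -big_distrr; congr (_ * _).
  apply: (@sum_maj_rearrangements _ _ _ (fun v => (nat_of_ord (d v), v.+1))).
  by move=> u v [_ uv]; apply: val_inj.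
rewrite -big_distrl -(bigA_distr_bigA (fun _ (j : 'I_l.+1) => q ^+ j)) /=.
rewrite prodr_const card_ord -[n in X in _ ^+ X](subn1 n.+1) -prodr_const_nat -big_split /=.
by apply: eq_bigr => k _; rewrite sum_exp_mul.
Qed.

(** * The polynomial identity *)

Lemma qpoch_neq0 (Q : K) n : (forall k, Q ^+ k.+1 != 1) -> qpoch Q Q n != 0.
Proof.
by move=> Q_free; apply/prodf_neq0 => k _; rewrite -exprS subr_eq0 eq_sym Q_free.
Qed.

Lemma qbinE (Q : K) n k : (forall j, Q ^+ j.+1 != 1) -> (k <= n)%N ->
  qbin Q n k = gauss Q n k.
Proof.
move=> Q_free kn; rewrite /qbin [qpoch Q Q n](esym (gauss_prod Q kn)).
by rewrite mulfK // mulf_neq0 ?qpoch_neq0.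
Qed.

(** * The generating polynomial of [fmaf] and [fixn] *)

Section FmafSums.
Variables (F : comNzRingType) (q : F) (l : nat).
Let Q : F := q ^+ l.+1.

Definition fmaf_sum n m : {poly F} :=
  \sum_(s : colperm l.+1 n | inGm m s) (q ^+ fmaf s)%:P * 'X ^+ fixn s.

Definition dermaj n : F :=
  \sum_(s : colperm l.+1 n | inGm 0 s) q ^+ Defs.col s * Q ^+ maj (Der s).

Lemma fmaf_sumS n m : (m <= n)%N ->
  fmaf_sum n.+1 m.+1 = fmaf_sum n.+1 m + (Q ^+ (n - m))%:P * 'X * fmaf_sum n m.
Proof.
move=> mn; rewrite /fmaf_sum sum_inGmS //; congr (_ + _).
rewrite big_distrr; apply: eq_bigr => s /forallP Gs /=.
have pE : (inord (n - m) : 'I_n.+1) = (n - m)%N :> nat by rewrite inordK // ltnS leq_subr.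
have nofix (i : 'I_n) : (i < (inord (n - m) : 'I_n.+1))%N -> ~~ isfix s i.
  by rewrite pE => /(implyP (Gs i)).
rewrite fmaf_insfix // fixn_insfix // pE; move: (fmaf s) (fixn s) => a b.
by rewrite exprD exprM -/Q polyCM exprS; ring.
Qed.

(** In the recurrence [fmaf_sumS] the two contributions to a coefficient share a power of [Q], and
    what remains is [gaussS]. *)
Lemma fmaf_sumE n m : (m <= n)%N ->
  fmaf_sum n m =
  \sum_(k < n.+1) (Q ^+ (k * (n - m)) * gauss Q m k * dermaj (n - k))%:P * 'X ^+ k.
Proof.
elim: m n => [|m IHm] n mn.
  rewrite big_ord_recl big1 => [|k _]; last by rewrite mulr0 mul0r mul0r.
  rewrite addr0 mulr1 mul0n !mul1r subn0 /fmaf_sum /dermaj rmorph_sum.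
  apply: eq_bigr => s /forallP Ds /=.
  have FIX0 : FIXs s = [::].
    rewrite /FIXs (@eq_filter _ _ pred0) ?filter_pred0 // => i.
    by apply/negbTE; have := Ds i; rewrite subn0 ltn_ord.
  by rewrite /fixn /fmaf /maf FIX0 /= big_ord0 addn0 exprD exprM -/Q mulr1 mulrC.
case: n mn => // n; rewrite ltnS => mn.
rewrite fmaf_sumS // (IHm _ (leqW mn)) (IHm _ mn) subSS.
rewrite big_ord_recl [in RHS]big_ord_recl /= !mul0n !gauss0 -addrA; congr (_ + _).
rewrite big_distrr -big_split; apply: eq_bigr => k _ /=.
rewrite [bump 0 k]add1n add0n subSS subSn // mulnS mulSn !exprD !exprS.
rewrite -/Q !(polyCM, polyCD); ring.
Qed.

End FmafSums.

(** * q-Appell sequences *)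

Section AppellPolynomials.
Variables (F : fieldType) (q : F) (l : nat).
Let Q : F := q ^+ l.
Hypothesis Q_free : forall k, Q ^+ k.+1 != 1.

(** The hypotheses are f_n(Qx) - f_n(x) = (Q^n - 1) x f_{n-1}(x) read on coefficients. As [Q] is no
    root of unity, they fix all coefficients but the constant one, which the value at 1 supplies. *)
Lemma q_appell_uniq (f1 f2 : nat -> {poly F}) :
  (forall n j, (1 - Q ^+ j.+1) * (f1 n.+1)`_j.+1 = (1 - Q ^+ n.+1) * (f1 n)`_j) ->
  (forall n j, (1 - Q ^+ j.+1) * (f2 n.+1)`_j.+1 = (1 - Q ^+ n.+1) * (f2 n)`_j) ->
  f1 0%N = f2 0%N -> (forall n, (f1 n).[1] = (f2 n).[1]) -> f1 =1 f2.
Proof.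
move=> H1 H2 f0 f_1; elim=> [//|n IHn].
apply/eqP; rewrite -subr_eq0; apply/eqP; set d := _ - _.
have coefS j : d`_j.+1 = 0.
  apply: (mulfI (_ : 1 - Q ^+ j.+1 != 0)); first by rewrite subr_eq0 eq_sym Q_free.
  by rewrite mulr0 coefB mulrBr H1 H2 IHn subrr.
have dC : d = (d`_0)%:P by apply/polyP => -[|j]; rewrite coefC //= coefS.
move: (d`_0) dC => c dC.
have : d.[1] = 0 by rewrite hornerD hornerN f_1 subrr.
by rewrite dC hornerC => ->; rewrite polyC0.
Qed.

Definition qfall k : {poly F} := \prod_(i < k) ('X - (q ^+ (l * i))%:P).

(** Replacing x by Qx shifts the roots, so the product and its dilation share the factor [qfall k];
    this is the resulting identity on coefficients. *)
Lemma coef_qfall k j :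
  (1 - Q ^+ j.+1) * (qfall k.+1)`_j.+1 = (1 - Q ^+ k.+1) * (qfall k)`_j.
Proof.
have qfallS i : qfall i.+1 = qfall i * 'X - qfall i * (Q ^+ i)%:P.
  by rewrite /qfall big_ord_recr /= mulrBr /Q -exprM.
have qfall_coef0 i : (qfall i.+1)`_0 = - ((qfall i)`_0 * Q ^+ i).
  by rewrite qfallS coefB coefMX coefMC sub0r.
have qfall_coefS i a : (qfall i.+1)`_a.+1 = (qfall i)`_a - (qfall i)`_a.+1 * Q ^+ i.
  by rewrite qfallS coefB coefMX coefMC.
elim: k j => [|k IHk] j.
  rewrite qfall_coefS; have -> : qfall 0 = 1 by rewrite /qfall big_ord0.
  by rewrite !coef1 /= mul0r subr0; case: j => [|j]; rewrite ?mulr0.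
rewrite qfall_coefS mulrBr mulrA IHk.
case: j => [|j].
  by rewrite qfall_coef0 !exprS expr0; ring.
have := IHk j; rewrite (qfall_coefS k j) => H.
apply/eqP; rewrite -subr_eq0; apply/eqP.
transitivity (Q * ((1 - Q ^+ j.+1) * ((qfall k)`_j - (qfall k)`_j.+1 * Q ^+ k)
   - (1 - Q ^+ k.+1) * (qfall k)`_j)); last by rewrite H subrr mulr0.
rewrite !exprS; ring.
Qed.

Definition geo n : F := \sum_(i < n) q ^+ i.

Definition geo_fact n : F := \prod_(1 <= j < n.+1) geo (j * l).

(** [gln] with [qq] replaced by an element of any field. *)
Definition gpoly n : {poly F} :=
  (geo_fact n)%:P * \sum_(k < n.+1) qfall k * ((geo_fact k)^-1)%:P.

Lemma geo_mul k : (1 - q) * geo (k * l) = 1 - Q ^+ k.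
Proof.
by rewrite /Q -exprM mulnC -[RHS]opprB subrX1 -mulNr opprB.
Qed.

Lemma geo_neq0 k : geo (k.+1 * l) != 0.
Proof.
have : 1 - Q ^+ k.+1 != 0 by rewrite subr_eq0 eq_sym Q_free.
by rewrite -geo_mul mulf_eq0 negb_or => /andP[].
Qed.

Lemma geo_fact_neq0 n : geo_fact n != 0.
Proof.
rewrite /geo_fact big_add1 /= big_mkord; apply/prodf_neq0 => i _; exact: geo_neq0.
Qed.

Lemma geo_factS n : geo_fact n.+1 = geo_fact n * geo (n.+1 * l).
Proof. by rewrite /geo_fact big_nat_recr. Qed.

(** The term [k = 0] is constant; term [k.+1] on the left matches term [k] on the right by
    [coef_qfall], the factorials accounting for the quotient. *)
Lemma coef_gpoly n j :
  (1 - Q ^+ j.+1) * (gpoly n.+1)`_j.+1 = (1 - Q ^+ n.+1) * (gpoly n)`_j.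
Proof.
rewrite /gpoly !coefCM big_ord_recl coefD !coef_sum.
have -> : qfall (nat_of_ord (@ord0 n.+1)) = 1 by rewrite /qfall big_ord0.
rewrite mul1r coefC add0r !big_distrr; apply: eq_bigr => k _ /=.
rewrite !coefMC mulrCA [X in _ * X]mulrA coef_qfall.
rewrite !geo_factS -!geo_mul; field.
by rewrite geo_fact_neq0 geo_neq0.
Qed.

Lemma gpoly_horner1 n : (gpoly n).[1] = geo_fact n.
Proof.
rewrite /gpoly hornerCM horner_sum big_ord_recl big1 => [|k _].
  rewrite /qfall big_ord0 mul1r hornerC /geo_fact.
  by rewrite [X in _ * (X^-1 + _)]big_geq // invr1 addr0 mulr1.
rewrite hornerM /qfall big_ord_recl /= hornerM hornerXsubC muln0 subrr.
by rewrite !mul0r.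
Qed.

End AppellPolynomials.

Lemma fmaf_sum_gpoly (F : fieldType) (q : F) l n :
  (forall k, (q ^+ l.+1) ^+ k.+1 != 1) -> fmaf_sum q l n n = gpoly q l.+1 n.
Proof.
move=> Q_free; set Q := q ^+ l.+1 in Q_free.
(* The case [m = n] of [fmaf_sumE], where the extra power of [Q] is trivial and [gauss_absorb]
   yields the Appell recurrence. *)
pose f m : {poly F} := \poly_(k < m.+1) (gauss Q m k * dermaj q l (m - k)).
have fE m : fmaf_sum q l m m = f m.
  rewrite fmaf_sumE // /f poly_def; apply: eq_bigr => k _.
  by rewrite subnn muln0 mul1r mul_polyC.
have f1 m : (f m).[1] = geo_fact q l.+1 m.
  rewrite -[RHS]sum_fmaj sum_maj_der horner_poly; apply: eq_bigr => k _.
  by rewrite expr1n mulr1.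
rewrite fE; move: n; apply: (q_appell_uniq Q_free) => [n j|||n].
- rewrite !coef_poly ltnS; case: ltnP => [jn|]; last by rewrite !mulr0.
  by rewrite subSS mulrA gauss_absorb mulrA.
- exact: coef_gpoly.
- have f0 : f 0 = (f 0).[1]%:P.
    by rewrite horner_poly /f poly_def !big_ord1 mulr1 expr0 alg_polyC.
  have g0 : gpoly q l.+1 0 = 1.
    by rewrite /gpoly big_ord1 /geo_fact big_geq // invr1 /qfall big_ord0 !mul1r.
  by rewrite f0 f1 g0 /geo_fact big_geq.
- by rewrite f1 gpoly_horner1.
Qed.

Lemma qq_free k : qq ^+ k.+1 != 1.
Proof.
rewrite /qq -tofracXn -tofrac1 tofrac_eq.
apply/eqP => /(congr1 (fun p : {poly int} => size p)).
by rewrite size_polyXn size_poly1.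
Qed.

(** * The explicit alternating sum *)

Definition q_expansion (R : comNzRingType) (Q : R) (G : nat -> {poly R}) n m :=
  \sum_(k < (n - m).+1)
     ((- 1) ^+ k * gauss Q (n - m) k * Q ^+ 'C(k, 2))%:P * 'X ^+ k * G (n - k)%N.

Lemma q_expansionS (R : comNzRingType) (Q : R) (G : nat -> {poly R}) n m :
  (m <= n)%N ->
  q_expansion Q G n.+1 m.+1 =
  q_expansion Q G n.+1 m + 'X * (Q ^+ (n - m))%:P * q_expansion Q G n m.
Proof.
move=> mn; rewrite /q_expansion subSS subSn //; set N := (n - m)%N.
rewrite [X in _ = X + _]big_ord_recl /=.
(* Adding the vanishing term [k = N.+1] gives both sides the same range. *)
transitivity (\sum_(k < N.+2)
    ((- 1) ^+ k * gauss Q N k * Q ^+ 'C(k, 2))%:P * 'X ^+ k * G (n.+1 - k)%N).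
  by rewrite [RHS]big_ord_recr /= gauss_small // mulr0 !mul0r ?polyC0 ?mul0r addr0.
rewrite big_ord_recl /= gauss0 -addrA; congr (_ + _).
rewrite big_distrr -big_split; apply: eq_bigr => k _.
have kN : (k <= N)%N by rewrite -ltnS.
rewrite /= [bump 0 k]add1n add0n -gaussS gaussS' subSS binS bin1 !exprS [Q ^+ (_ + _)]exprD /=.
have -> : Q ^+ N = Q ^+ (N - k) * Q ^+ k by rewrite -exprD subnK.
rewrite !(polyCM, polyCD, polyCN); ring.
Qed.

Lemma gln_gpoly l n : gln l n = gpoly qq l n.
Proof. by []. Qed.

Theorem theorem2 (l : nat) (hl : (1 <= l)%N) (g : nat -> nat -> {poly K})
  (hgn : forall n, g n n = gln l n)
  (hgrec : forall n m, (m < n)%N ->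
     g n m = g n m.+1 - 'X * (qq ^+ (l * (n - m - 1)))%:P * g n.-1 m) :
  forall n m, (m <= n)%N ->
    g n m = \sum_(k < (n - m).+1)
              ((- 1) ^+ k * qbin (qq ^+ l) (n - m) k * qq ^+ (l * 'C(k, 2)))%:P
                * 'X ^+ k * gln l (n - k)
  /\ g n m = \sum_(s : colperm l n | inGm m s) (qq ^+ fmaf s)%:P * 'X ^+ fixn s.
Proof.
case: l hl hgn hgrec => // l _ hgn hgrec.
have Q_free k : (qq ^+ l.+1) ^+ k.+1 != 1 by rewrite -exprM mulSn addSn qq_free.
(* The recurrence expresses an entry through two entries with smaller [n - m], so the diagonal
   determines everything; both formulas are instances of [h]. *)
have uniq (h : nat -> nat -> {poly K}) : (forall n, h n n = gln l.+1 n) ->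
    (forall n m, (m <= n)%N ->
      h n.+1 m.+1 = h n.+1 m + 'X * ((qq ^+ l.+1) ^+ (n - m))%:P * h n m) ->
    forall n m, (m <= n)%N -> g n m = h n m.
  move=> hn hrec n m; move dE : (n - m)%N => d; elim: d n m dE => [|d IHd] n m dE mn.
    have -> : n = m by lia.
    by rewrite hgn hn.
  case: n dE mn => [|n] dE mn; first by lia.
  have mn' : (m <= n)%N by lia.
  rewrite hgrec // /= IHd; [|lia|lia].
  rewrite hrec // IHd; [|lia|lia].
  by rewrite exprM subSn // subn1 /= addrK.
move=> n m mn; split; last first.
  apply: (uniq (fmaf_sum qq l)) mn => [k|k j jk].
    by rewrite gln_gpoly fmaf_sum_gpoly.
  by rewrite fmaf_sumS // ['X * _]mulrC.
have -> : g n m = q_expansion (qq ^+ l.+1) (gln l.+1) n m.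
  apply: uniq mn => [k|k j jk]; last exact: q_expansionS.
  rewrite /q_expansion subnn big_ord1 gauss0 subn0 bin0n !expr0 !mulr1.
  by rewrite polyC1 mul1r.
apply: eq_bigr => k _; have kn : (k <= n - m)%N by rewrite -ltnS.
by rewrite (qbinE Q_free kn) [qq ^+ (l.+1 * 'C(_, _))]exprM.
Qed.
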